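(* Consider the semidefinite program (all data defined in the context) $$\begin{aligned}\max_{\alpha,\widehat u,\delta,\{\vartheta_j,\theta_j\}_{j=1}^{M_T}}\ &\delta\\ \text{s.t.}\quad &(\alpha,\widehat u)\in\widehat{\mathcal U},\\ &(\vartheta_j,\alpha,\bar\rho_T+\delta)\in\mathcal K,\quad j=1,\dots,M_T,\\ &\theta_j>0,\quad j=1,\dots,M_T,\\ &\delta\ge\varepsilon_T,\\ &\begin{bmatrix}X_{T,j}&\alpha B_j\\ \alpha B_j^\top&\theta_jI_n\end{bmatrix}\succeq0,\quad j=1,\dots,M_T,\end{aligned}$$ and suppose that it has a feasible solution $(\alpha_T,\widehat u_T,\delta_T,\{\vartheta_j,\theta_{T,j}\}_{j=1}^{M_T})$. If $\alpha_T>0$ and the input $u_T=\widehat u_T/\alpha_T$ is applied, then for every admissible future observation $x_{T+1}=y$ (i.e. every $y=\Theta w_T(u_T)+e$ with $\Theta\in\Sigma_T$ and $ee^\top\preceq\Omega_T$), the optimal value $\rho_{T+1}^\star$ obtained with the data extended by $(u_T,y)$ satisfies $$\rho_{T+1}^\star\ge\bar\rho_T+\delta_T .$$ Moreover, if $\delta_T\ge\varepsilon_T$, then $$\rho_{T+1}^\star\ge\rho_T^\star .$$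
   Context: Notation: $\succeq,\preceq,\succ$ denote the Loewner order; for $Q\succeq0$, $Q^{1/2}$ is the symmetric positive semidefinite square root and, for $Q\succ0$, $Q^{-1/2}=(Q^{1/2})^{-1}$; $\operatorname{He}(M)=M+M^\top$; $\|\cdot\|=\|\cdot\|_2$ is the Euclidean norm. Data. Let $p=n+m$. Measurements come from an unknown controllable system $x_{t+1}=A_\star x_t+B_\star u_t+e_t$, $x_t\in\mathbb R^n$, $u_t\in\mathbb R^m$, $e_t\in\mathbb R^n$ unmeasured. Put $X_T=[x_0\ \cdots\ x_{T-1}]$, $U_T=[u_0\ \cdots\ u_{T-1}]$, $Y_T=[x_1\ \cdots\ x_T]$, $E_T=[e_0\ \cdots\ e_{T-1}]$, $W_T=\begin{bmatrix}X_T\\ U_T\end{bmatrix}\in\mathbb R^{p\times T}$. Standing assumptions: $W_T$ has full row rank $p$; there are known symmetric $\Delta_t\in\mathbb R^{n\times n}$ with $E_TE_T^\top\preceq\Delta_T$ for every $T$; with $\Omega_T:=\Delta_{T+1}-\Delta_T$, the disturbance at time $T$ satisfies $e_Te_T^\top\preceq\Omega_T$; the set $\mathcal U\subset\mathbb R^m$ of admissible inputs is compact (described by any combination of constraints of the form $\|u\|_\infty\le\bar u_\infty$, $\|u\|_2\le\bar u_2$, $(u-u_c)^\top H_u^{-1}(u-u_c)\le1$, $Gu\le g$). Data-consistent systems: $\Sigma_T=\{\Theta\in\mathbb R^{n\times p}:(Y_T-\Theta W_T)(Y_T-\Theta W_T)^\top\preceq\Delta_T\}$. Define $\mathbf A_T=W_TW_T^\top\succ0$,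 $\mathbf B_T=-W_TY_T^\top$, $\boldsymbol\zeta_T=-\mathbf A_T^{-1}\mathbf B_T\in\mathbb R^{p\times n}$, $\mathbf Q_T=\mathbf B_T^\top\mathbf A_T^{-1}\mathbf B_T-Y_TY_T^\top+\Delta_T\succeq0$. Certificate and performance index. Let $$N_T=\begin{bmatrix}\Delta_T&0\\ 0&0_p\end{bmatrix}-\begin{bmatrix}Y_T\\ -W_T\end{bmatrix}\begin{bmatrix}Y_T\\ -W_T\end{bmatrix}^\top,\qquad \mathcal C_T(\vartheta,\alpha,\rho)=\mathcal F(\vartheta,\rho)-\alpha\,ON_TO^\top,$$ where $\mathcal F$ is a data-independent symmetric-matrix-valued map, affine in the decision variables $\vartheta$ and in $\rho\in\mathbb R$; $O$ is a constant matrix with $n+p$ columns; $\alpha\ge0$ is a scalar. $\mathcal K$ is a data-independent constraint set for $(\vartheta,\alpha,\rho)$, all of whose elements have $\alpha\ge0$. The performance index is $$\rho_T^\star=\sup\{\rho:\exists(\vartheta,\alpha,\rho)\in\mathcal K\text{ with }\mathcal C_T(\vartheta,\alpha,\rho)\succeq0\}.$$ $\mathcal C_{T+1}$ and $\rho_{T+1}^\star$ are defined in the same way from the data over $[0,T+1]$, with $\Delta_{T+1}=\Delta_T+\Omega_T$ and the same $\mathcal F,O,\mathcal K$. Reference certificate. $\varepsilon_T>0$ is fixed and $(\bar\vartheta_T,\bar\alpha_T,\bar\rho_T)\in\mathcal K$ is such that $\mathcal C_T(\bar\vartheta_T,\bar\alpha_T,\bar\rho_T)\succeq0$ and $\rho_T^\star\ge\bar\rho_T\ge\rho_T^\star-\varepsilon_T$.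 Next-step quantities. $x_T$ is known; for $u\in\mathcal U$ let $w_T(u)=\begin{bmatrix}x_T\\ u\end{bmatrix}$, $\bar y_T(u)=\boldsymbol\zeta_T^\top w_T(u)$, $\sigma_T(u)=\sqrt{w_T(u)^\top\mathbf A_T^{-1}w_T(u)}$. Let $J=O\begin{bmatrix}I_n\\ 0_{p\times n}\end{bmatrix}$, $\mathbf R_h=J\Omega_TJ^\top$, $h_0(u)=O\begin{bmatrix}\bar y_T(u)\\ -w_T(u)\end{bmatrix}$. Reference input $u_T^{\rm fd}$. Let $\mathcal V_T$ be the eigenspace of $\mathcal C_T(\bar\vartheta_T,\bar\alpha_T,\bar\rho_T)$ for its smallest eigenvalue, $\bar z_T\in\arg\max\{\|O^\top z\|:z\in\mathcal V_T,\|z\|=1\}$, $O^\top\bar z_T=\begin{bmatrix}\bar a_T\\ \bar b_T\end{bmatrix}$ with $\bar a_T\in\mathbb R^n,\bar b_T\in\mathbb R^p$, $\bar c_T=\boldsymbol\zeta_T\bar a_T-\bar b_T$, $\eta_T=\|\mathbf Q_T^{1/2}\bar a_T\|$. For $s\in\{+1,-1\}$ consider: maximize $\mu$ over $(u,t,\mu)$ subject to $u\in\mathcal U$, $\|\mathbf A_T^{-1/2}w_T(u)\|\le t$, $s\,\bar c_T^\top w_T(u)-\eta_Tt-\sqrt{\bar a_T^\top\Omega_T\bar a_T}\ge\mu$. Then $u_T^{\rm fd}\in\mathcal U$ is the input part of an optimal solution for a sign $s$ attaining the larger of the two optimal values. Cover. Fix a finite $\bar\sigma_T$ with $\sigma_T(u)\le\bar\sigma_T$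 for all $u\in\mathcal U$ and let $\mathcal R_T=\{\mathbf Q_T^{1/2}v+\Omega_T^{1/2}z:\|v\|_2\le\bar\sigma_T,\|z\|_2\le1\}$. Fix $c_j\in\mathbb R^n$, $D_j=D_j^\top\succ0$ in $\mathbb R^{n\times n}$, $j=1,\dots,M_T$, such that $\mathcal R_T\subseteq\bigcup_{j=1}^{M_T}\mathcal R_{T,j}$ with $\mathcal R_{T,j}=\{c_j+D_jz:\|z\|_2\le1\}$. For each $j$ put $h_{0,j}(u)=h_0(u)+Jc_j$, $B_j=JD_j$, $\bar h_j=h_{0,j}(u_T^{\rm fd})$. Scaled variables. $\widehat{\mathcal U}=\{(\alpha,\widehat u):\alpha>0,\ \widehat u/\alpha\in\mathcal U\}$. With $\widehat w=\begin{bmatrix}\alpha x_T\\ \widehat u\end{bmatrix}$, let $\widehat h_{0,j}=O\begin{bmatrix}\boldsymbol\zeta_T^\top\widehat w\\ -\widehat w\end{bmatrix}+\alpha Jc_j$ (which equals $\alpha h_{0,j}(u)$ for $\widehat u=\alpha u$). Fix a constant $\nu_T\ge0$ and set $$X_{T,j}=\mathcal C_T(\vartheta_j,\alpha,\bar\rho_T+\delta)+\operatorname{He}(\bar h_j\widehat h_{0,j}^\top)-(\alpha+\theta_j)\bar h_j\bar h_j^\top-\alpha\mathbf R_h-\nu_TI .$$ *)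

(* Defs.v *)
From HB Require Import structures.
From mathcomp Require Import all_boot all_order all_algebra.
From mathcomp Require Import all_classical all_reals all_analysis.

Set Implicit Arguments.
Unset Strict Implicit.
Unset Printing Implicit Defensive.

Import Order.TTheory GRing.Theory Num.Theory.
Import numFieldNormedType.Exports.
Local Open Scope classical_set_scope.
Local Open Scope ring_scope.

Definition psdmx (R : realType) (k : nat) (A : 'M[R]_k) : Prop :=
  A^T = A /\ forall v : 'cV[R]_k, 0 <= (v^T *m A *m v) 0 0.

Definition pdmx (R : realType) (k : nat) (A : 'M[R]_k) : Prop :=
  A^T = A /\ forall v : 'cV[R]_k, v != 0 -> 0 < (v^T *m A *m v) 0 0.

Definition loewner_le (R : realType) (k : nat) (A B : 'M[R]_k) : Prop :=
  psdmx (B - A).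

(* The positive semidefinite square root of A; it is unique, and it exists
   as soon as [psdmx A] (the value is 0 when there is none). *)
Definition sqrtmx (R : realType) (k : nat) (A : 'M[R]_k) : 'M[R]_k :=
  xget 0 [set S | psdmx S /\ S *m S = A].

Definition He (R : realType) (k : nat) (A : 'M[R]_k) : 'M[R]_k := A + A^T.

(* Euclidean norm; the library norm [mx_norm] on matrices is the max norm. *)
Definition enorm (R : realType) (k : nat) (v : 'cV[R]_k) : R :=
  Num.sqrt (\sum_(i < k) v i 0 ^+ 2).

Definition horizon (R : realType) (k : nat) (T : nat) (s : nat -> 'cV[R]_k) :
    'M[R]_(k, T) :=
  \matrix_(i < k, t < T) s t i 0.

Definition controllable (R : realType) (n m : nat)
    (A : 'M[R]_n) (B : 'M[R]_(n, m)) : Prop :=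
  \rank (\mxrow_(i < n) (A ^+ i *m B)) = n.

Inductive input_constraint (R : realType) (m : nat) : Type :=
| BoxConstraint (r : R)
| BallConstraint (r : R)
| EllipsoidConstraint (uc : 'cV[R]_m) (H : 'M[R]_m) of H \in unitmx
| PolyhedralConstraint (k : nat) (G : 'M[R]_(k, m)) (g : 'cV[R]_k).

Definition satisfies (R : realType) (m : nat) (u : 'cV[R]_m)
    (c : input_constraint R m) : Prop :=
  match c with
  | BoxConstraint r => mx_norm u <= r
  | BallConstraint r => enorm u <= r
  | @EllipsoidConstraint _ _ uc H _ =>
      ((u - uc)^T *m invmx H *m (u - uc)) 0 0 <= 1
  | @PolyhedralConstraint _ _ k G g => forall i : 'I_k, (G *m u) i 0 <= g i 0
  end.

Definition described_by (R : realType) (m q : nat) (U : set 'cV[R]_m)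
    (cs : 'I_q -> input_constraint R m) : Prop :=
  U = [set u | forall i : 'I_q, satisfies u (cs i)].

(* Below, the arguments [Delta], [Y], [W] are the disturbance bound and the
   matrices of successors and of stacked states and inputs over any horizon. *)

Definition data_consistent (R : realType) (n p T : nat)
    (Delta : 'M[R]_n) (Y : 'M[R]_(n, T)) (W : 'M[R]_(p, T)) :
    set 'M[R]_(n, p) :=
  [set Theta | loewner_le ((Y - Theta *m W) *m (Y - Theta *m W)^T) Delta].

Definition dataA (R : realType) (p T : nat) (W : 'M[R]_(p, T)) : 'M[R]_p :=
  W *m W^T.

Definition dataB (R : realType) (n p T : nat)
    (Y : 'M[R]_(n, T)) (W : 'M[R]_(p, T)) : 'M[R]_(p, n) :=
  - (W *m Y^T).

Definition dataZeta (R : realType) (n p T : nat)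
    (Y : 'M[R]_(n, T)) (W : 'M[R]_(p, T)) : 'M[R]_(p, n) :=
  - (invmx (dataA W) *m dataB Y W).

Definition dataQ (R : realType) (n p T : nat)
    (Delta : 'M[R]_n) (Y : 'M[R]_(n, T)) (W : 'M[R]_(p, T)) : 'M[R]_n :=
  (dataB Y W)^T *m invmx (dataA W) *m dataB Y W - Y *m Y^T + Delta.

Definition dataN (R : realType) (n p T : nat)
    (Delta : 'M[R]_n) (Y : 'M[R]_(n, T)) (W : 'M[R]_(p, T)) :
    'M[R]_(n + p) :=
  block_mx Delta 0 0 0 - col_mx Y (- W) *m (col_mx Y (- W))^T.

Definition jointly_affine (R : realType) (V W : lmodType R)
    (F : V -> R -> W) : Prop :=
  forall (a : R) (v v' : V) (r r' : R),
    F (a *: v + (1 - a) *: v') (a * r + (1 - a) * r') =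
    a *: F v r + (1 - a) *: F v' r'.

Definition certificate (R : realType) (n p N T : nat) (V : vectType R)
    (F : V -> R -> 'M[R]_N) (O : 'M[R]_(N, n + p))
    (Delta : 'M[R]_n) (Y : 'M[R]_(n, T)) (W : 'M[R]_(p, T))
    (vartheta : V) (alpha rho : R) : 'M[R]_N :=
  F vartheta rho - alpha *: (O *m dataN Delta Y W *m O^T).

Definition performance_index (R : realType) (n p N T : nat) (V : vectType R)
    (F : V -> R -> 'M[R]_N) (O : 'M[R]_(N, n + p)) (K : set (V * R * R))
    (Delta : 'M[R]_n) (Y : 'M[R]_(n, T)) (W : 'M[R]_(p, T)) : \bar R :=
  ereal_sup [set rho%:E | rho in
    [set rho : R | exists (vartheta : V) (alpha : R),
       K (vartheta, alpha, rho) /\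
       psdmx (certificate F O Delta Y W vartheta alpha rho)]].

Definition smallest_eigenvalue (R : realType) (k : nat) (C : 'M[R]_k)
    (lambda : R) : Prop :=
  eigenvalue C lambda /\ forall mu, eigenvalue C mu -> lambda <= mu.

(* [z^T] is used because [eigenspace] consists of row vectors (left
   eigenvectors); this is immaterial for the symmetric matrices at hand. *)
Definition is_leading_direction (R : realType) (k q : nat) (C : 'M[R]_k)
    (O : 'M[R]_(k, q)) (z : 'cV[R]_k) : Prop :=
  exists lambda : R,
    [/\ smallest_eigenvalue C lambda,
        (z^T <= eigenspace C lambda)%MS,
        enorm z = 1 &
        forall z' : 'cV[R]_k, (z'^T <= eigenspace C lambda)%MS ->
          enorm z' = 1 -> enorm (O^T *m z') <= enorm (O^T *m z)].

Section ReferenceInput.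
Context (R : realType) (n m p : nat).
Context (U : set 'cV[R]_m) (w : 'cV[R]_m -> 'cV[R]_p).
Context (A : 'M[R]_p) (Q Omega : 'M[R]_n) (zeta : 'M[R]_(p, n)).
Context (a : 'cV[R]_n) (b : 'cV[R]_p).

Definition fd_feasible (s : R) (q : 'cV[R]_m * R * R) : Prop :=
  let: (u, t, mu) := q in
  let c := zeta *m a - b in
  let eta := enorm (sqrtmx Q *m a) in
  [/\ U u,
      enorm (invmx (sqrtmx A) *m w u) <= t &
      mu <= s * (c^T *m w u) 0 0 - eta * t
            - Num.sqrt ((a^T *m Omega *m a) 0 0)].

Definition fd_value (s : R) : \bar R :=
  ereal_sup [set q.2%:E | q in fd_feasible s].

Definition fd_optimal (s : R) (q : 'cV[R]_m * R * R) : Prop :=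
  fd_feasible s q /\ forall q', fd_feasible s q' -> q'.2 <= q.2.

Definition is_fd_input (u : 'cV[R]_m) : Prop :=
  exists s : R,
    [/\ s = 1 \/ s = -1,
        forall s', s' = 1 \/ s' = -1 -> (fd_value s' <= fd_value s)%E &
        exists t mu, fd_optimal s (u, t, mu)].

End ReferenceInput.

(* Main.v *)
Require Import Defs.
From HB Require Import structures.
From mathcomp Require Import all_boot all_order all_algebra.
From mathcomp Require Import complex ring lra.
From mathcomp Require Import all_classical all_reals all_analysis.

Set Implicit Arguments.
Unset Strict Implicit.
Unset Printing Implicit Defensive.

Import Order.TTheory GRing.Theory Num.Theory.
Import numFieldNormedType.Exports.
Local Open Scope classical_set_scope.
Local Open Scope ring_scope.

(* Completing the square turns consistency of [Theta] with the data into
   [(Theta - zeta^T) A (Theta - zeta^T)^T <= Q], so Cauchy-Schwarz together with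
   the factorization of rank-one matrices dominated by [S^2] shows that
   [y - ybar(u_T)] lies in the covered set, hence [h = h_{0,j}(u_T) + B_j z] with
   [|z| <= 1] for some [j].  Appending [(u_T, y)] to the data changes the
   certificate by [alpha h h^T - alpha R_h].  The LMI for that [j] is a
   linearization at [hbar_j] of positivity of the new certificate, robust over
   [|z| <= 1]; so the new certificate is psd for the level
   [rhobar + delta_T]. *)

(** * Interpolation and polynomials of a matrix *)

(** Newton interpolation: a new node is corrected by a multiple of the product vanishing at all
    earlier ones; a repeated node needs no correction. *)
Lemma poly_interpolation (K : fieldType) (s : seq K) (f : K -> K) :
  exists p : {poly K}, {in s, forall a, p.[a] = f a}.
Proof.
elim: s => [|a s [p pE]]; first by exists 0.
have [as_in | as_notin] := boolP (a \in s).
  exists p => b; rewrite inE => /orP[/eqP -> |]; exact: pE.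
pose g := \prod_(b <- s) ('X - b%:P).
have ga : g.[a] != 0 by rewrite -[_ == 0]/(root g a) root_prod_XsubC.
exists (p + ((f a - p.[a]) / g.[a])%:P * g) => b.
rewrite inE hornerD hornerM hornerC; have [-> _ | _ /= bs] := eqVneq b a.
  by rewrite divfK // addrC subrK.
have /rootP -> : root g b by rewrite root_prod_XsubC.
by rewrite mulr0 addr0 pE.
Qed.

Lemma trmx_horner_mx (K : comNzRingType) (n : nat) (A : 'M[K]_n.+1)
  (p : {poly K}) : (horner_mx A p)^T = horner_mx A^T p.
Proof.
elim/poly_ind: p => [|p c IH]; first by rewrite !rmorph0 trmx0.
rewrite !rmorphD !rmorphM /= !horner_mx_X !horner_mx_C linearD /=.
rewrite -[_ * A]/(_ *m A) trmx_mul IH tr_scalar_mx.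
congr (_ + _); rewrite -[LHS]/(_ * _) -{1}[A^T]horner_mx_X.
by rewrite -rmorphM /= mulrC rmorphM /= horner_mx_X.
Qed.

Section RealMatrices.
Context (R : realType).

(** * Euclidean inner product *)

Lemma trmx11 (A : 'M[R]_1) : A^T = A.
Proof. by apply/matrixP => i j; rewrite !mxE !ord1. Qed.

Lemma dotmxC (k : nat) (v w : 'cV[R]_k) : v^T *m w = w^T *m v.
Proof. by rewrite -[LHS]trmx11 trmx_mul trmxK. Qed.

Lemma enorm_sqr (k : nat) (v : 'cV[R]_k) : enorm v ^+ 2 = (v^T *m v) 0 0.
Proof.
rewrite sqr_sqrtr; last by apply: sumr_ge0 => i _; exact: sqr_ge0.
by rewrite !mxE; apply: eq_bigr => i _; rewrite mxE expr2.
Qed.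

Lemma enorm_ge0 (k : nat) (v : 'cV[R]_k) : 0 <= enorm v.
Proof. exact: sqrtr_ge0. Qed.

Lemma dotmx_ge0 (k : nat) (v : 'cV[R]_k) : 0 <= (v^T *m v) 0 0.
Proof. by rewrite -enorm_sqr sqr_ge0. Qed.

Lemma dotmx_eq0 (k : nat) (v : 'cV[R]_k) : (v^T *m v) 0 0 = 0 -> v = 0.
Proof.
rewrite mxE => /eqP; rewrite psumr_eq0; last first.
  by move=> i _; rewrite mxE -expr2 sqr_ge0.
move=> /allP vi; apply/colP => i; rewrite mxE.
have /= := vi i (mem_index_enum i); rewrite mxE -expr2 sqrf_eq0.
by move=> /eqP.
Qed.

(** * Spectral decomposition and square roots *)

Lemma psdmx_eigenvalue_ge0 (k : nat) (A : 'M[R]_k) (a : R) :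
  psdmx A -> eigenvalue A a -> 0 <= a.
Proof.
move=> [_ Age0] /eigenvalueP[v vA v0].
have := Age0 v^T; rewrite trmxK vA -scalemxAl mxE pmulr_lge0 //.
have := dotmx_ge0 v^T; rewrite trmxK le_eqVlt => /orP[/eqP/esym|//].
rewrite -{1}[v]trmxK => /dotmx_eq0 /(congr1 trmx); rewrite trmxK trmx0 => v_eq0.
by rewrite v_eq0 eqxx in v0.
Qed.

Lemma symmetric_diagonalization (k : nat) (A : 'M[R]_k) : A^T = A ->
  exists (P : 'M[R[i]]_k) (d : 'rV[R]_k),
    [/\ P \in unitmx,
        map_mx (real_complex R) A
          = invmx P *m diag_mx (map_mx (real_complex R) d) *m P &
        forall i, eigenvalue A (d 0 i)].
Proof.
move=> Asym; set Ac := map_mx _ A.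
have Acsym : Ac \is symmetricmx.
  apply/is_hermitianmxP; rewrite expr0 scale1r map_mx_id //.
  by rewrite /Ac map_trmx Asym.
have Acreal : Ac \is a mxOver Num.real.
  by apply/mxOverP => i j; rewrite !mxE complex_real.
have dreal := hermitian_spectral_diag_real (realsym_hermsym Acsym Acreal).
have /orthomx_spectralP Aceq := symmetric_normalmx Acsym Acreal.
set P := spectralmx Ac in Aceq; set dc := spectral_diag Ac in Aceq dreal.
have Punit : P \in unitmx := spectral_unit Ac.
pose d := map_mx (@complex.Re R) dc.
have dE : map_mx (real_complex R) d = dc.
  apply/rowP => i; rewrite !mxE RRe_real //.
  by move/mxOverP: dreal; apply.
exists P, d; split=> [||i]; [exact: Punit | by rewrite dE; exact: Aceq |].
(* Being an eigenvalue is a root condition on the characteristic polynomial, so it can be checked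
   over the complex numbers, with row [i] of [P] as left eigenvector. *)
rewrite eigenvalue_root_char -(fmorph_root (real_complex R)).
rewrite map_char_poly -eigenvalue_root_char; apply/eigenvalueP.
exists (row i P); last first.
  apply/eqP => /(congr1 (mulmx^~ (invmx P))).
  rewrite -row_mul mulmxV // mul0mx => /rowP/(_ i).
  by rewrite !mxE eqxx => /eqP; rewrite oner_eq0.
rewrite -row_mul -/Ac Aceq !mulmxA mulmxV // mul1mx row_mul row_diag_mx.
by rewrite -scalemxAl -rowE -dE !mxE.
Qed.

(* The square root is a polynomial in [A] with real coefficients, so the complex
   spectral theorem yields it without passing to a real eigenbasis. It is
   built as the square of a symmetric fourth root, whence it is psd. *)
Lemma psdmx_sqrt_exists (k : nat) (A : 'M[R]_k) : psdmx A ->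
  exists S : 'M[R]_k, psdmx S /\ S *m S = A.
Proof.
case: k A => [|k] A Apsd.
  (* Size zero is trivial; [horner_mx] below takes a size of the form [k.+1]. *)
  by exists A; split=> //; apply/matrixP => [[]].
have [P [d [Punit AE d_eig]]] := symmetric_diagonalization Apsd.1.
have [p pE] := poly_interpolation [seq d 0 i | i : 'I_k.+1]
  (fun a => Num.sqrt (Num.sqrt a)).
pose T := horner_mx A p.
have TT : T^T = T by rewrite trmx_horner_mx Apsd.1.
exists (T *m T); split.
  split=> [|v]; first by rewrite trmx_mul TT.
  by rewrite -{1}TT -!mulmxA mulmxA -trmx_mul dotmx_ge0.
(* After embedding into the complex matrices, [P] diagonalizes both sides, and [p ^+ 4] fixes every
   eigenvalue. *)
apply: (map_mx_inj (f := real_complex R)).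
rewrite -[LHS]/(map_mx _ (T * T * (T * T))) /T -!rmorphM /= map_horner_mx AE.
rewrite horner_mx_uconjC; last exact: Punit.
rewrite horner_mx_diag; set e := map_mx (horner _) _.
suff eE : e = map_mx (real_complex R) d by rewrite eE.
apply/rowP => i; rewrite !mxE horner_map /= !hornerM pE ?map_f ?mem_enum //.
have d_ge0 : 0 <= d 0 i by apply: psdmx_eigenvalue_ge0 Apsd (d_eig i).
by rewrite -!expr2 !sqr_sqrtr // ?sqrtr_ge0.
Qed.

Lemma sqrtmxP (k : nat) (A : 'M[R]_k) : psdmx A ->
  psdmx (sqrtmx A) /\ sqrtmx A *m sqrtmx A = A.
Proof.
move=> /psdmx_sqrt_exists[S SP]; rewrite /sqrtmx.
by case: xgetP => [S' _ //|/(_ S)/(_ SP)].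
Qed.

(** * Quadratic forms, Cauchy-Schwarz and the Loewner order *)

Lemma mulmx11E (A B : 'M[R]_1) : (A *m B) 0 0 = A 0 0 * B 0 0.
Proof. by rewrite mxE big_ord1. Qed.

Lemma bilin_sym (k : nat) (A : 'M[R]_k) (v w : 'cV[R]_k) : A^T = A ->
  w^T *m A *m v = v^T *m A *m w.
Proof. by move=> AT; rewrite -[LHS]trmx11 !trmx_mul trmxK AT mulmxA. Qed.

Lemma qformD (k : nat) (A : 'M[R]_k) (v w : 'cV[R]_k) (a b : R) : A^T = A ->
  ((a *: v + b *: w)^T *m A *m (a *: v + b *: w)) 0 0 =
  a ^+ 2 * (v^T *m A *m v) 0 0 + 2 * a * b * (v^T *m A *m w) 0 0
  + b ^+ 2 * (w^T *m A *m w) 0 0.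
Proof.
move=> AT; have -> : (a *: v + b *: w)^T = a *: v^T + b *: w^T by rewrite linearD !linearZ.
rewrite !mulmxDl !mulmxDr -!scalemxAl -!scalemxAr.
rewrite (bilin_sym _ _ AT).
move: (v^T *m A *m v) (v^T *m A *m w) (w^T *m A *m w) => p r q.
by rewrite !mxE; ring.
Qed.

Lemma psdmx_cauchy_schwarz (k : nat) (A : 'M[R]_k) (v w : 'cV[R]_k) :
  psdmx A -> (v^T *m A *m w) 0 0 ^+ 2
             <= (v^T *m A *m v) 0 0 * (w^T *m A *m w) 0 0.
Proof.
move=> [AT A0]; have := A0 w; have := A0 v.
have {A0} := fun a b => A0 (a *: v + b *: w).
have {}AT a b := qformD v w a b AT.
move=> H; have {AT}H a b := eq_ind _ (fun z => 0 <= z) (H a b) _ (AT a b).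
move: H.
move: ((v^T *m A *m v) 0 0) ((v^T *m A *m w) 0 0) ((w^T *m A *m w) 0 0).
move=> p r q H p0 q0; have [q_eq0|q_neq0] := eqVneq q 0.
  (* For [q = 0] this choice gives [- r^2 (p + 2) >= 0], which forces [r = 0]. *)
  have := H r (- (p + 1)); rewrite q_eq0 !mulr0 addr0.
  have := mulr_ge0 (sqr_ge0 r) p0; nra.
have q_gt0 : 0 < q by rewrite lt_def q_neq0.
(* Up to scaling, [(q, - r)] minimizes the binary form; its value there is [q (p q - r^2)]. *)
have := H q (- r).
have -> : q ^+ 2 * p + 2 * q * - r * r + (- r) ^+ 2 * q = q * (p * q - r ^+ 2).
  by ring.
by rewrite pmulr_rge0 // subr_ge0.
Qed.

Lemma loewner_le_qform (k : nat) (A B : 'M[R]_k) (v : 'cV[R]_k) :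
  loewner_le A B -> (v^T *m A *m v) 0 0 <= (v^T *m B *m v) 0 0.
Proof.
case=> _ /(_ v); rewrite mulmxBr mulmxBl.
by move: (v^T *m A *m v) (v^T *m B *m v) => a b; rewrite !mxE subr_ge0.
Qed.

Lemma outer_qform (k : nat) (d v : 'cV[R]_k) :
  (v^T *m (d *m d^T) *m v) 0 0 = (v^T *m d) 0 0 ^+ 2.
Proof. by rewrite mulmxA -mulmxA mulmx11E dotmxC -expr2. Qed.

Lemma psdmx_gram (k l : nat) (E : 'M[R]_(k, l)) : psdmx (E *m E^T).
Proof.
split=> [|v]; first by rewrite trmx_mul trmxK.
by rewrite mulmxA -mulmxA -[v^T *m E]trmxK trmx_mul trmxK dotmx_ge0.
Qed.

Lemma psdmx_congr (k l : nat) (G : 'M[R]_(k, l)) (A : 'M[R]_l) :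
  psdmx A -> psdmx (G *m A *m G^T).
Proof.
move=> [AT A0]; split=> [|v]; first by rewrite !trmx_mul trmxK AT mulmxA.
by have := A0 (G^T *m v); rewrite trmx_mul trmxK !mulmxA.
Qed.

Lemma loewner_le_psdmx (k : nat) (A B : 'M[R]_k) :
  psdmx A -> loewner_le A B -> psdmx B.
Proof.
move=> [AT A0] AB; split=> [|v].
  by case: AB => BAT _; rewrite -(subrK A B) linearD /= BAT AT.
by apply: le_trans (A0 v) (loewner_le_qform v AB).
Qed.

(* A rank-one instance of Douglas' factorization lemma. *)
Lemma sqrtmx_range (k : nat) (Q : 'M[R]_k) (g : 'cV[R]_k) (kappa : R) :
  psdmx Q ->
  (forall a : 'cV[R]_k, (a^T *m g) 0 0 ^+ 2 <= kappa * (a^T *m Q *m a) 0 0) ->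
  exists v : 'cV[R]_k, g = sqrtmx Q *m v /\ enorm v <= Num.sqrt kappa.
Proof.
move=> Qpsd gQ; have [[ST _] SS] := sqrtmxP Qpsd.
(* The bound makes [g] orthogonal to the kernel of the symmetric [Q], so [g] lies in its range. *)
have /submxP[x gx] : (g^T <= Q)%MS.
  rewrite submxE; apply/eqP/rowP => j; rewrite [RHS]mxE.
  have := gQ (cokermx Q *m delta_mx j 0).
  rewrite -[_ *m Q *m _]mulmxA [Q *m _]mulmxA mulmx_coker mul0mx mulmx0.
  rewrite [X in kappa * X]mxE mulr0 => /(conj (sqr_ge0 _))/andP/le_anti/esym/eqP.
  by rewrite sqrf_eq0 dotmxC mulmxA -colE mxE => /eqP.
have {gx} g_eq : g = Q *m x^T by rewrite -[g]trmxK gx trmx_mul Qpsd.1.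
exists (sqrtmx Q *m x^T); split; first by rewrite mulmxA SS.
have vE : enorm (sqrtmx Q *m x^T) ^+ 2 = (x *m g) 0 0.
  by rewrite enorm_sqr trmx_mul ST trmxK g_eq -!mulmxA [_ *m (_ *m x^T)]mulmxA SS.
(* With [v = sqrtmx Q *m x^T], testing at [x^T] gives [|v|^4 <= kappa |v|^2]. *)
have := gQ x^T; rewrite trmxK -mulmxA -g_eq -vE => vle.
have [->|v_neq0] := eqVneq (enorm (sqrtmx Q *m x^T)) 0; first exact: sqrtr_ge0.
have v_gt0 : 0 < enorm (sqrtmx Q *m x^T) ^+ 2 by rewrite exprn_even_gt0.
rewrite -[leLHS]ger0_norm ?enorm_ge0 // -sqrtr_sqr ler_wsqrtr //.
by rewrite -(ler_pM2r v_gt0) -expr2.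
Qed.

(** * Consistent systems and their prediction error *)

(* [dataQ] is the Schur complement obtained by completing the square in
   [Theta]. *)
Lemma data_consistent_ellipsoid (n p T : nat) (Delta : 'M[R]_n)
    (Y : 'M[R]_(n, T)) (W : 'M[R]_(p, T)) (Theta : 'M[R]_(n, p)) :
  dataA W \in unitmx -> data_consistent Delta Y W Theta ->
  loewner_le ((Theta - (dataZeta Y W)^T) *m dataA W *m (Theta - (dataZeta Y W)^T)^T)
             (dataQ Delta Y W).
Proof.
(* Both Loewner inequalities have the same difference, so an identity of matrices remains. *)
move=> Aunit; rewrite /data_consistent /= /loewner_le; congr psdmx.
have AT : (dataA W)^T = dataA W by rewrite /dataA trmx_mul trmxK.
have BT : (dataB Y W)^T = - (Y *m W^T) by rewrite /dataB linearN /= trmx_mul trmxK.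
have zT : (dataZeta Y W)^T = - ((dataB Y W)^T *m invmx (dataA W)).
  by rewrite /dataZeta linearN /= trmx_mul trmx_inv AT.
have -> : (Theta - (dataZeta Y W)^T)^T = Theta^T + invmx (dataA W) *m dataB Y W.
  by rewrite zT opprK [LHS]linearD /= trmx_mul trmx_inv AT trmxK.
rewrite zT opprK !mulmxDl !mulmxDr.
rewrite mulmxKV // (mulmxA (Theta *m _)) mulmxK // (mulmxA _^T _ (dataB Y W)).
have -> : (Y - Theta *m W)^T = Y^T - W^T *m Theta^T by rewrite [LHS]linearB /= trmx_mul.
rewrite /dataQ; set BAB := _ *m invmx _ *m _.
rewrite BT /dataB /dataA !mulmxBr !mulmxN !mulNmx !mulmxA.
move: (Y *m Y^T) (Y *m W^T *m _) (Theta *m W *m Y^T) (Theta *m W *m _ *m _).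
by move=> P1 P2 P3 P4; apply/matrixP => i j; rewrite !mxE; ring.
Qed.

(** If [v W W^T = 0] then [|v W|^2 = 0], and full row rank gives [v = 0]. *)
Lemma dataA_unit (p T : nat) (W : 'M[R]_(p, T)) : \rank W = p ->
  dataA W \in unitmx.
Proof.
move=> Wrank; rewrite -row_free_unit -kermx_eq0; apply/eqP/row_matrixP => i.
rewrite row0; set v := row i _.
have vA : v *m dataA W = 0 by rewrite -row_mul mulmx_ker row0.
have /dotmx_eq0/(congr1 trmx) : ((v *m W)^T^T *m (v *m W)^T) 0 0 = 0.
  by rewrite trmxK trmx_mul mulmxA -[v *m W *m _]mulmxA vA mul0mx mxE.
rewrite trmxK trmx0 => vW; apply/eqP.
by rewrite -(mulmx_free_eq0 _ (_ : row_free W)) ?vW // /row_free Wrank.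
Qed.

Lemma data_consistent_residual (n p T : nat) (Delta : 'M[R]_n)
    (Y : 'M[R]_(n, T)) (W : 'M[R]_(p, T)) (Theta : 'M[R]_(n, p))
    (w : 'cV[R]_p) :
  \rank W = p -> data_consistent Delta Y W Theta ->
  psdmx (dataQ Delta Y W) /\
  exists v : 'cV[R]_n,
    (Theta - (dataZeta Y W)^T) *m w = sqrtmx (dataQ Delta Y W) *m v /\
    enorm v <= Num.sqrt ((w^T *m invmx (dataA W) *m w) 0 0).
Proof.
move=> Wrank Theta_in; have Aunit := dataA_unit Wrank.
have := data_consistent_ellipsoid Aunit Theta_in.
move: (Theta - _) => G.
have := psdmx_gram W; rewrite -/(dataA W).
move: (dataA W) (dataQ _ _ _) Aunit => A Q Aunit Apsd GQ.
have Qpsd := loewner_le_psdmx (psdmx_congr G Apsd) GQ.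
split=> //; apply: sqrtmx_range => // a.
(* In the inner product of [A], the vectors [G^T a] and [A^-1 w] have product [a^T G w]; the squared
   norm of the first is at most [a^T Q a]. *)
have := psdmx_cauchy_schwarz (G^T *m a) (invmx A *m w) Apsd.
rewrite !trmx_mul trmxK trmx_inv Apsd.1 !mulmxA mulmxK // mulmxKV // => /le_trans.
apply; rewrite mulrC ler_wpM2l //.
  have := Apsd.2 (invmx A *m w).
  by rewrite !trmx_mul trmx_inv Apsd.1 !mulmxA mulmxKV.
by have := loewner_le_qform a GQ; rewrite !mulmxA.
Qed.

Lemma disturbance_factor (n : nat) (Omega : 'M[R]_n) (d : 'cV[R]_n) :
  loewner_le (d *m d^T) Omega ->
  psdmx Omega /\ exists z : 'cV[R]_n, d = sqrtmx Omega *m z /\ enorm z <= 1.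
Proof.
move=> dO; have Opsd := loewner_le_psdmx (psdmx_gram d) dO; split=> //.
have [|z [dz]] := @sqrtmx_range _ _ d 1 Opsd; last first.
  by rewrite sqrtr1 => z1; exists z.
by move=> a; rewrite mul1r -outer_qform; exact: loewner_le_qform.
Qed.

(** * From the block inequality to a positive certificate *)

Lemma psdmx_block_qform (k l : nat) (A : 'M[R]_k) (B : 'M[R]_(k, l))
    (D : 'M[R]_l) (v : 'cV[R]_k) (s : 'cV[R]_l) :
  psdmx (block_mx A B B^T D) ->
  0 <= (v^T *m A *m v) 0 0 + 2 * (v^T *m B *m s) 0 0 + (s^T *m D *m s) 0 0.
Proof.
case=> _ /(_ (col_mx v s)); rewrite tr_col_mx mul_row_block mul_row_col !mulmxDl.
have -> : s^T *m B^T *m v = v^T *m B *m s.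
  by rewrite -[LHS]trmx11 !trmx_mul !trmxK mulmxA.
move: (v^T *m A *m v) (v^T *m B *m s) (s^T *m D *m s) => a b d.
by rewrite !mxE; congr (_ <= _); ring.
Qed.

(* The block inequality, tested on [(v, b z)] with [b = v^T hbar], bounds the
   quadratic form of the conclusion at [v] below by
   [alpha (a - b)^2 + theta b^2 (1 - |z|^2)], where [a = v^T (h0 + B z)]. *)
Lemma linearized_lmi_psdmx (N n : nat) (C L : 'M[R]_N) (B : 'M[R]_(N, n))
    (hbar h0 hhat : 'cV[R]_N) (z : 'cV[R]_n) (alpha theta nu : R) :
  C^T = C -> L^T = L -> 0 <= alpha -> 0 <= theta -> 0 <= nu -> enorm z <= 1 ->
  hhat = alpha *: h0 ->
  psdmx (block_mx (C + He (hbar *m hhat^T)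
                     - (alpha + theta) *: (hbar *m hbar^T) - L - nu%:M)
                  (alpha *: B) (alpha *: B^T) theta%:M) ->
  psdmx (C - L + alpha *: ((h0 + B *m z) *m (h0 + B *m z)^T)).
Proof.
move=> CT LT alpha0 theta0 nu0 z1 ->; set X := (X in block_mx X).
have XE : X = C - L + He (hbar *m (alpha *: h0)^T)
              - (alpha + theta) *: (hbar *m hbar^T) - nu%:M.
  by rewrite /X; congr (_ - _); rewrite [LHS]addrAC; congr (_ - _); exact: addrAC.
have {LT} : (C - L)^T = C - L by rewrite linearB /= CT LT.
move: (C - L) X XE => {CT}C X XE CT.
have -> : alpha *: B^T = (alpha *: B)^T by rewrite linearZ.
move=> Xpsd; split=> [|v]; first by rewrite linearD linearZ /= trmx_mul trmxK CT.
set b := (v^T *m hbar) 0 0; set c := (v^T *m h0) 0 0.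
set a := (v^T *m (h0 + B *m z)) 0 0.
have Bz : (v^T *m B *m z) 0 0 = a - c.
  by rewrite /a /c -mulmxA mulmxDr [X in X - _]mxE addrC addrK.
(* The cross terms [2 alpha b c] and [2 alpha b (a - c)] add up to [2 alpha a b], so [h0] and [B z]
   enter only through [a]. *)
have := psdmx_block_qform v (b *: z) Xpsd.
have -> : (v^T *m (alpha *: B) *m (b *: z)) 0 0 = alpha * b * (a - c).
  rewrite -Bz -!scalemxAr -scalemxAl; move: (v^T *m B *m z) => r.
  by rewrite !mxE; ring.
have -> : ((b *: z)^T *m theta%:M *m (b *: z)) 0 0 = theta * b ^+ 2 * enorm z ^+ 2.
  have -> : (b *: z)^T = b *: z^T by rewrite linearZ.
  rewrite enorm_sqr mul_mx_scalar -!scalemxAl -scalemxAr.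
  by move: (z^T *m z) => r; rewrite !mxE; ring.
have -> : (v^T *m X *m v) 0 0 = (v^T *m C *m v) 0 0 + 2 * alpha * b * c
    - (alpha + theta) * b ^+ 2 - nu * enorm v ^+ 2.
  rewrite XE /He trmx_mul trmxK !mulmxBr !mulmxDr !mulmxBl !mulmxDl.
  have -> : v^T *m (hbar *m (alpha *: h0)^T) *m v = (alpha * b * c)%:M.
    have -> : (alpha *: h0)^T = alpha *: h0^T by rewrite linearZ.
    rewrite -!scalemxAr -scalemxAl mulmxA -(mulmxA (v^T *m hbar)).
    apply/matrixP => i j; rewrite !ord1 [LHS]mxE mulmx11E [h0^T *m v]dotmxC.
    by rewrite [RHS]mxE eqxx mulr1n mulrA.
  have -> : v^T *m (alpha *: h0 *m hbar^T) *m v = (alpha * b * c)%:M.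
    rewrite -scalemxAl -!scalemxAr -scalemxAl mulmxA -(mulmxA (v^T *m h0)).
    apply/matrixP => i j; rewrite !ord1 [LHS]mxE mulmx11E [hbar^T *m v]dotmxC.
    by rewrite [RHS]mxE eqxx mulr1n -/b -/c; ring.
  rewrite -scalemxAr -scalemxAl mul_mx_scalar -scalemxAl enorm_sqr /b -outer_qform.
  move: (v^T *m C *m v) (v^T *m (hbar *m hbar^T) *m v) (v^T *m v) => p r q.
  by rewrite !mxE /= !mulr1n; ring.
have -> : (v^T *m (C + alpha *: ((h0 + B *m z) *m (h0 + B *m z)^T)) *m v) 0 0
    = (v^T *m C *m v) 0 0 + alpha * a ^+ 2.
  rewrite mulmxDr mulmxDl -scalemxAr -scalemxAl /a -outer_qform.
  by move: (v^T *m C *m v) (v^T *m _ *m v) => p r; rewrite !mxE.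
have z2 : enorm z ^+ 2 <= 1 by rewrite expr_le1 // enorm_ge0.
have : 0 <= alpha * (a - b) ^+ 2 by rewrite mulr_ge0 // sqr_ge0.
have : 0 <= theta * b ^+ 2 * (1 - enorm z ^+ 2).
  by apply: mulr_ge0; rewrite ?subr_ge0 // mulr_ge0 // sqr_ge0.
have : 0 <= nu * enorm v ^+ 2 by rewrite mulr_ge0 // sqr_ge0.
nra.
Qed.

(** * The certificate after one more sample *)

(** A new column subtracts a rank-one term from [dataN], while the larger disturbance bound adds a
    block. The factor [- alpha] in the certificate reverses both signs: the sample helps and the
    noise bound costs. *)
Lemma certificate_update (n p N T : nat) (V : vectType R)
    (F : V -> R -> 'M[R]_N) (O : 'M[R]_(N, n + p)) (Delta Delta' : 'M[R]_n)
    (Y : 'M[R]_(n, T)) (W : 'M[R]_(p, T)) (y : 'cV[R]_n) (w : 'cV[R]_p)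
    (vartheta : V) (alpha rho : R)
    (J := O *m col_mx (1%:M : 'M[R]_n) (0 : 'M[R]_(p, n)))
    (h := O *m col_mx y (- w)) :
  certificate F O Delta' (row_mx Y y) (row_mx W w) vartheta alpha rho =
  certificate F O Delta Y W vartheta alpha rho
  - alpha *: (J *m (Delta' - Delta) *m J^T) + alpha *: (h *m h^T).
Proof.
have hE : h *m h^T = O *m (col_mx y (- w) *m (col_mx y (- w))^T) *m O^T.
  by rewrite /h trmx_mul !mulmxA.
have JE : J *m (Delta' - Delta) *m J^T = O *m block_mx (Delta' - Delta) 0 0 0 *m O^T.
  rewrite /J trmx_mul !mulmxA; congr (_ *m _); rewrite -!mulmxA; congr (_ *m _).
  rewrite tr_col_mx trmx1 trmx0 mulmxA mul_col_mx mul1mx mul0mx mul_col_row.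
  by rewrite mulmx1 !mulmx0 mul0mx.
have NE : dataN Delta' (row_mx Y y) (row_mx W w) =
    dataN Delta Y W + block_mx (Delta' - Delta) 0 0 0
    - col_mx y (- w) *m (col_mx y (- w))^T.
  rewrite /dataN.
  have -> : col_mx (row_mx Y y) (- row_mx W w) =
            row_mx (col_mx Y (- W)) (col_mx y (- w)) .
    by rewrite opp_row_mx -block_mxEv block_mxEh.
  rewrite tr_row_mx mul_row_col.
  have -> : block_mx Delta' 0 0 0 =
            block_mx Delta 0 0 0 + block_mx (Delta' - Delta) 0 0 0 :> 'M[R]_(n + p).
    by rewrite add_block_mx !addr0 addrC subrK.
  by rewrite opprD !addrA; congr (_ - _); rewrite addrAC.
rewrite /certificate NE hE JE mulmxBr mulmxDr mulmxBl mulmxDl.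
set P1 := O *m dataN _ _ _ *m _; set P2 := O *m block_mx _ _ _ _ *m _.
set P3 := O *m _ *m _; move: P1 P2 P3 => P1 P2 P3.
by apply/matrixP => i j; rewrite !mxE; ring.
Qed.

Lemma certificate_sym (n p N T : nat) (V : vectType R)
    (F : V -> R -> 'M[R]_N) (O : 'M[R]_(N, n + p)) (Delta : 'M[R]_n)
    (Y : 'M[R]_(n, T)) (W : 'M[R]_(p, T)) (vartheta : V) (alpha rho : R) :
  Delta^T = Delta -> (F vartheta rho)^T = F vartheta rho ->
  (certificate F O Delta Y W vartheta alpha rho)^T =
  certificate F O Delta Y W vartheta alpha rho.
Proof.
move=> DT FT.
have NT : (dataN Delta Y W)^T = dataN Delta Y W.
  rewrite /dataN [LHS]linearB /= tr_block_mx DT !trmx0.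
  by rewrite [X in _ - X]trmx_mul trmxK.
rewrite /certificate [LHS]linearB linearZ /= FT; congr (_ - _ *: _).
by rewrite !trmx_mul trmxK NT mulmxA.
Qed.

End RealMatrices.

(* MathComp-Analysis, over an arbitrary realType *)
Theorem theorem2 (R : realType) (n m N T M : nat) (V : vectType R)
  (* unknown system, recorded data, disturbance bounds *)
  (Astar : 'M[R]_n) (Bstar : 'M[R]_(n, m))
  (x : nat -> 'cV[R]_n) (u : nat -> 'cV[R]_m) (e : nat -> 'cV[R]_n)
  (Delta : nat -> 'M[R]_n)
  (Y := horizon T (fun t => x t.+1))
  (W := col_mx (horizon T x) (horizon T u))
  (Omega := Delta T.+1 - Delta T)
  (hctrl : controllable Astar Bstar)
  (hdyn : forall t, (t < T)%N ->
     x t.+1 = Astar *m x t + Bstar *m u t + e t)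
  (hrank : \rank W = (n + m)%N)
  (hDelta : forall t, (Delta t)^T = Delta t)
  (hE : forall t, loewner_le (horizon t e *m (horizon t e)^T) (Delta t))
  (heT : loewner_le (e T *m (e T)^T) Omega)
  (* admissible inputs *)
  (U : set 'cV[R]_m) (q : nat) (cs : 'I_q -> input_constraint R m)
  (hU : compact U) (hUcs : described_by U cs)
  (* certificate *)
  (F : V -> R -> 'M[R]_N) (O : 'M[R]_(N, n + (n + m))) (K : set (V * R * R))
  (hFaff : jointly_affine F)
  (hFsym : forall vartheta rho, (F vartheta rho)^T = F vartheta rho)
  (hK : forall vartheta alpha rho, K (vartheta, alpha, rho) -> 0 <= alpha)
  (C := certificate F O (Delta T) Y W)
  (rhostar := performance_index F O K (Delta T) Y W)
  (* reference certificate *)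
  (eps : R) (varthetabar : V) (alphabar rhobar : R)
  (heps : 0 < eps)
  (hKbar : K (varthetabar, alphabar, rhobar))
  (hCbar : psdmx (C varthetabar alphabar rhobar))
  (hrhobar_le : (rhobar%:E <= rhostar)%E)
  (hrhobar_ge : (rhostar - eps%:E <= rhobar%:E)%E)
  (* next-step quantities *)
  (A := dataA W) (zeta := dataZeta Y W) (Q := dataQ (Delta T) Y W)
  (w := fun v : 'cV[R]_m => col_mx (x T) v)
  (ybar := fun v : 'cV[R]_m => zeta^T *m w v)
  (sigma := fun v : 'cV[R]_m =>
     Num.sqrt (((w v)^T *m invmx A *m w v) 0 0))
  (J := O *m col_mx (1%:M : 'M[R]_n) (0 : 'M[R]_(n + m, n)))
  (Rh := J *m Omega *m J^T)
  (h0 := fun v : 'cV[R]_m => O *m col_mx (ybar v) (- w v))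
  (* reference input *)
  (zbar : 'cV[R]_N) (ufd : 'cV[R]_m)
  (abar := usubmx (O^T *m zbar)) (bbar := dsubmx (O^T *m zbar))
  (hzbar : is_leading_direction (C varthetabar alphabar rhobar) O zbar)
  (hufd : is_fd_input U w A Q Omega zeta abar bbar ufd)
  (* cover *)
  (sigmabar : R) (c : 'I_M -> 'cV[R]_n) (D : 'I_M -> 'M[R]_n)
  (hsigmabar : forall v, U v -> sigma v <= sigmabar)
  (hD : forall j, pdmx (D j))
  (hcover :
     [set r | exists v z : 'cV[R]_n, [/\ enorm v <= sigmabar, enorm z <= 1 &
        r = sqrtmx Q *m v + sqrtmx Omega *m z]]
     `<=` \bigcup_(j in [set: 'I_M])
        [set r | exists z : 'cV[R]_n, enorm z <= 1 /\ r = c j + D j *m z])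
  (h0j := fun (j : 'I_M) (v : 'cV[R]_m) => h0 v + J *m c j)
  (B := fun j : 'I_M => J *m D j)
  (hbar := fun j : 'I_M => h0j j ufd)
  (* scaled variables *)
  (Uhat := [set q : R * 'cV[R]_m | 0 < q.1 /\ U (q.1^-1 *: q.2)])
  (what := fun (alpha : R) (uhat : 'cV[R]_m) => col_mx (alpha *: x T) uhat)
  (h0hat := fun (j : 'I_M) (alpha : R) (uhat : 'cV[R]_m) =>
     O *m col_mx (zeta^T *m what alpha uhat) (- what alpha uhat)
     + alpha *: (J *m c j))
  (nu : R) (hnu : 0 <= nu)
  (X := fun (j : 'I_M) (alpha : R) (uhat : 'cV[R]_m) (delta : R)
            (vartheta : V) (theta : R) =>
     C vartheta alpha (rhobar + delta)
     + He (hbar j *m (h0hat j alpha uhat)^T)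
     - (alpha + theta) *: (hbar j *m (hbar j)^T)
     - alpha *: Rh - nu%:M)
  (* feasible solution of the semidefinite program *)
  (alphaT : R) (uhatT : 'cV[R]_m) (deltaT : R)
  (vartheta : 'I_M -> V) (theta : 'I_M -> R)
  (hfeasU : Uhat (alphaT, uhatT))
  (hfeasK : forall j, K (vartheta j, alphaT, rhobar + deltaT))
  (hfeastheta : forall j, 0 < theta j)
  (hfeasdelta : eps <= deltaT)
  (hfeasLMI : forall j,
     psdmx (block_mx (X j alphaT uhatT deltaT (vartheta j) (theta j))
                     (alphaT *: B j)
                     (alphaT *: (B j)^T)
                     ((theta j)%:M : 'M[R]_n)))
  (halphaT : 0 < alphaT)
  (uT := alphaT^-1 *: uhatT)
  (* admissible future observation *)
  (y : 'cV[R]_n)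
  (hy : exists (Theta : 'M[R]_(n, n + m)) (d : 'cV[R]_n),
     [/\ data_consistent (Delta T) Y W Theta, loewner_le (d *m d^T) Omega &
         y = Theta *m w uT + d])
  (rhostar_next :=
     performance_index F O K (Delta T.+1) (row_mx Y y) (row_mx W (w uT))) :
  ((rhobar + deltaT)%:E <= rhostar_next)%E /\
  (eps <= deltaT -> (rhostar <= rhostar_next)%E).
Proof.
have [Th [d [Th_in dO yE]]] := hy.
have [_ [v [vE vn]]] := data_consistent_residual (w uT) hrank Th_in.
have [Opsd [z [zE zn]]] := disturbance_factor dO.
(* The prediction error is [(Theta - zeta^T) w + d], with one summand from each part of the covered
   set. *)
have [j _ [s [s1 rE]]] : (\bigcup_(j in [set: 'I_M])
    [set r | exists z : 'cV[R]_n, enorm z <= 1 /\ r = c j + D j *m z])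
    (y - ybar uT).
  apply: hcover; exists v, z; split=> //.
    exact: le_trans vn (hsigmabar _ hfeasU.2).
  by rewrite -vE -zE yE mulmxBl addrAC.
have h_eq : O *m col_mx y (- w uT) = h0j j uT + B j *m s.
  rewrite /h0j /h0 /B /J -!mulmxA -addrA -!mulmxDr -rE; congr (_ *m _).
  by rewrite mul_col_mx mul1mx mul0mx add_col_mx addr0 addrC subrK.
have cert_psd : psdmx (certificate F O (Delta T.+1) (row_mx Y y)
    (row_mx W (w uT)) (vartheta j) alphaT (rhobar + deltaT)).
  rewrite (certificate_update F O (Delta T)) h_eq -/C -/J -/Omega -/Rh.
  (* Since [alphaT] is nonzero, [uhatT] is [alphaT] times the applied input, so the scaled vector is
     exactly [alphaT] times the true one. *)
  have hhatE : h0hat j alphaT uhatT = alphaT *: h0j j uT.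
    have whatE : what alphaT uhatT = alphaT *: w uT.
      by rewrite /w scale_col_mx scalerA mulfV ?gt_eqF // scale1r.
    by rewrite /h0hat whatE -scalemxAr -scalerN -scale_col_mx -scalemxAr -scalerDr.
  have CT : (C (vartheta j) alphaT (rhobar + deltaT))^T
      = C (vartheta j) alphaT (rhobar + deltaT) by exact: certificate_sym.
  have RhT : (alphaT *: Rh)^T = alphaT *: Rh.
    by rewrite linearZ /= (psdmx_congr J Opsd).1.
  exact: linearized_lmi_psdmx CT RhT (ltW halphaT) (ltW (hfeastheta j)) hnu s1
    hhatE (hfeasLMI j).
(* The piece [j] depends on [y], but all pieces share the level [rhobar + deltaT], so the bound
   holds for each [y]. *)
have next_ge : ((rhobar + deltaT)%:E <= rhostar_next)%E.
  by apply: ereal_sup_ubound; exists (rhobar + deltaT) => //; exists (vartheta j), alphaT.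
split=> [|_]; first exact: next_ge.
apply: le_trans next_ge.
(* The reference certificate is [eps]-optimal, and the guaranteed gain [deltaT] is at least
   [eps]. *)
have : (rhostar <= rhobar%:E + eps%:E)%E by rewrite -leeBlDr.
by move=> /le_trans; apply; rewrite -EFinD lee_fin lerD2l.
Qed.
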